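(* Let $\mathbf L=(L,\vee,\wedge)$ be a lattice, $a,b\in L$ with $a\le b$, and assume that $[a,b]$ is a modular sublattice of $\mathbf L$. Then the following are equivalent: (i) $[a,b]$ satisfies the identity $(x^{ab})^{ab}\approx x$, i.e. $(x^{ab})^{ab}=\{x\}$ for all $x\in[a,b]$; (ii) for every $x\in[a,b]$ and each $y\in(x^{ab})^{ab}$ there exists some $z\in y^{ab}$ satisfying either $(x\vee y)\wedge z=a$ or $(x\wedge y)\vee z=b$.
   Context: Here $[a,b]=\{w\in L\mid a\le w\le b\}$. For $x\in[a,b]$, $x^{ab}:=\{y\in[a,b]\mid x\vee y=b\text{ and }x\wedge y=a\}$; for a subset $A\subseteq[a,b]$, $A^{ab}:=\{y\in[a,b]\mid x\vee y=b\text{ and }x\wedge y=a\text{ for all }x\in A\}$. In (ii), ''either ... or'' is the inclusive or. *)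

(* Defs.v *)
From mathcomp Require Import all_boot all_order interval.
From mathcomp Require Import boolp classical_sets.

Set Implicit Arguments.
Unset Strict Implicit.
Unset Printing Implicit Defensive.

Local Open Scope order_scope.

Definition modular_sublattice (d : Order.disp_t) (L : latticeType d)
    (S : {pred L}) : Prop :=
  [/\ Order.ClosedPredicates.meet_closed S,
      Order.ClosedPredicates.join_closed S &
      {in S & &, forall x y z, x <= z -> (x `|` y) `&` z = x `|` (y `&` z)}].

(* x^{ab}, meaningful for x in [a, b] *)
Definition compl (d : Order.disp_t) (L : latticeType d) (a b x : L) : set L :=
  [set y | [/\ y \in `[a, b], (x `|` y)%O = b & (x `&` y)%O = a]]%classic.

(* A^{ab}, meaningful for A included in [a, b]; it is [a, b] if A is empty *)
Definition compl_set (d : Order.disp_t) (L : latticeType d) (a b : L)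
    (A : set L) : set L :=
  [set y | y \in `[a, b] /\
    forall x, A x -> (x `|` y)%O = b /\ (x `&` y)%O = a]%classic.

(* Main.v *)
Require Import Defs.
From mathcomp Require Import all_boot all_order interval.
From mathcomp Require Import boolp classical_sets.

Set Implicit Arguments.
Unset Strict Implicit.
Unset Printing Implicit Defensive.

Import Order.TTheory.

Local Open Scope order_scope.

(** In a modular interval two comparable elements sharing a complement are
    equal; this drives (ii) => (i). For y in the double complement of x, the
    element z of (ii) is a complement of y and also of x `|` y (or of x `&` y),
    so y equals that join (or meet), and x and y are comparable. They also have
    a common complement, because every complement of x is a complement of y, so
    they are equal. That x has a complement at all comes from (ii) itself,
    applied with y = x, which always lies in the double complement of x.

    Conversely, under (i) y must be x, so any complement z of x serves in (ii).
    A complement exists: if there were none, the double complement would be the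
    whole interval, (i) would collapse the interval to the point x, and then x
    would be its own complement. *)

(** The modular law for u <= v, namely (u `|` w) `&` v = u `|` (w `&` v), reads
    v = u once u `|` w is the top b and w `&` v the bottom a. Since u <= v, these
    two equations make w a common complement of u and v. *)
Lemma modular_comparable_eq (d : Order.disp_t) (L : latticeType d)
    (a b u v w : L) :
  modular_sublattice (mem `[a, b]) ->
  u \in `[a, b] -> v \in `[a, b] -> w \in `[a, b] ->
  u <= v -> u `|` w = b -> v `&` w = a -> u = v.
Proof.
case=> _ _ mod_ab u_ab v_ab w_ab le_uv uw_b vw_a.
have := mod_ab u w v u_ab w_ab v_ab le_uv.
move: u_ab v_ab; rewrite !in_itv /= => /andP[le_au _] /andP[_ le_vb].
by rewrite uw_b [w `&` v]meetC vw_a (meet_r le_vb) (join_l le_au).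
Qed.

(** In the definition of compl the interval is read as a classical set, whereas
    here, as in the hypotheses below, it is a boolean predicate on L. *)
Lemma complP (d : Order.disp_t) (L : latticeType d) (a b x y : L) :
  compl a b x y <-> [/\ y \in `[a, b], x `|` y = b & x `&` y = a].
Proof.
by split=> -[y_ab xy_b xy_a]; split=> //; move: y_ab; rewrite inE.
Qed.

Lemma compl_setP (d : Order.disp_t) (L : latticeType d) (a b : L) (A : set L)
    (y : L) :
  compl_set a b A y <->
  y \in `[a, b] /\ forall x, A x -> x `|` y = b /\ x `&` y = a.
Proof. by split=> -[y_ab yA]; split=> //; move: y_ab; rewrite inE. Qed.

Lemma mem_double_compl (d : Order.disp_t) (L : latticeType d) (a b x : L) :
  x \in `[a, b] -> compl_set a b (compl a b x) x.
Proof.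
move=> x_ab; apply/compl_setP; split=> // w /complP[_ xw_b xw_a].
by rewrite joinC meetC.
Qed.

Lemma compl_nonempty (d : Order.disp_t) (L : latticeType d) (a b x : L) :
  a <= b -> x \in `[a, b] -> compl_set a b (compl a b x) = [set x]%classic ->
  exists w, compl a b x w.
Proof.
move=> le_ab x_ab double_x; apply: contrapT => no_compl.
have eq_x y : y \in `[a, b] -> y = x.
  move=> y_ab; suff: compl_set a b (compl a b x) y by rewrite double_x.
  by apply/compl_setP; split=> // w xw; case: no_compl; exists w.
have a_x : a = x by apply: eq_x; rewrite in_itv /= lexx.
have b_x : b = x by apply: eq_x; rewrite in_itv /= lexx le_ab.
by apply: no_compl; exists x; apply/complP; split; rewrite // ?joinxx ?meetxx.
Qed.

Theorem theorem4p1 (d : Order.disp_t) (L : latticeType d) (a b : L)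
    (le_ab : a <= b) (mod_ab : modular_sublattice (mem `[a, b])) :
  (forall x : L, x \in `[a, b] ->
     compl_set a b (compl a b x) = [set x]%classic)
  <->
  (forall x : L, x \in `[a, b] ->
     forall y : L, compl_set a b (compl a b x) y ->
       exists z : L, compl a b y z /\
         ((x `|` y) `&` z = a \/ (x `&` y) `|` z = b)).
Proof.
split=> [double_compl | witness] x x_ab.
  move=> y; rewrite double_compl // => ->.
  have [z xz] := compl_nonempty le_ab x_ab (double_compl x x_ab).
  exists z; split=> //; left.
  by rewrite joinxx; case: xz.
rewrite eqEsubset; split=> [y yP | _ ->]; last exact: mem_double_compl.
have [w [/complP[w_ab xw_b xw_a] _]] := witness x x_ab x (mem_double_compl x_ab).
have /compl_setP[y_ab y_compl] := yP.
have [wy_b wy_a] : w `|` y = b /\ w `&` y = a by apply/y_compl/complP.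
have [z [/complP[z_ab yz_b yz_a] zP]] := witness x x_ab y yP.
have [meet_ab join_ab _] := mod_ab.
case: zP => [xyz_a | xyz_b].
- have y_join : y = x `|` y.
    apply: (modular_comparable_eq mod_ab y_ab _ z_ab) => //.
      exact: join_ab.
    exact: leUr.
  have le_xy : x <= y by rewrite y_join leUl.
  have yw_a : y `&` w = a by rewrite meetC.
  by rewrite /= -(modular_comparable_eq mod_ab x_ab y_ab w_ab le_xy).
- have y_meet : x `&` y = y.
    apply: (modular_comparable_eq mod_ab _ y_ab z_ab) => //.
      exact: meet_ab.
    exact: leIr.
  have le_yx : y <= x by rewrite -y_meet leIl.
  have yw_b : y `|` w = b by rewrite joinC.
  by rewrite /= (modular_comparable_eq mod_ab y_ab x_ab w_ab le_yx).
Qed.
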